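(* There exists $\delta_0>0$ such that for every constant $0<\delta<\delta_0$ the following holds. Let $d=d(n)$ with $1\le d\le n/2$ and let $k=k(n)$ be an integer with $n/\sqrt{d}\le k\le \sqrt{\delta}\,n$. Then w.h.p. $G_n\sim G(n,d/n)$ satisfies $$i_k(G_n)>\big(\delta\,(n/k)^{\delta/2}\big)^k.$$
   Context: $G(n,p)$ is the random graph on $[n]$ with each edge present independently with probability $p$; w.h.p. means with probability tending to 1 as $n\to\infty$. For a graph $G$, $i_k(G)$ is the number of unlabeled (isomorphism classes of) $k$-vertex induced subgraphs of $G$. *)

(* Defs.v *)
From HB Require Import structures.
From mathcomp Require Import all_boot all_order all_algebra.
From mathcomp Require Import all_classical all_reals all_analysis.
Set Implicit Arguments. Unset Strict Implicit. Unset Printing Implicit Defensive.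
Import Order.TTheory GRing.Theory Num.Theory.
Local Open Scope ring_scope.

Definition simple_graph (n : nat) (E : {set 'I_n * 'I_n}) : bool :=
  [forall x, (x, x) \notin E] &&
  [forall x, forall y, ((x, y) \in E) == ((y, x) \in E)].

Definition nedges (n : nat) (E : {set 'I_n * 'I_n}) : nat :=
  #|[set e in E | (e.1 < e.2)%N]|.

(* Probability that G(n,p) satisfies the property A: each of the 'C(n,2)
   possible edges is present independently with probability p. *)
Definition gnp_prob (R : realType) (n : nat) (p : R)
    (A : pred {set 'I_n * 'I_n}) : R :=
  \sum_(E : {set 'I_n * 'I_n} | simple_graph E && A E)
     p ^+ nedges E * (1 - p) ^+ ('C(n, 2) - nedges E).

Definition induced_iso (n : nat) (E : {set 'I_n * 'I_n})
    (S T : {set 'I_n}) : bool :=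
  [exists f : {ffun 'I_n -> 'I_n},
    [&& [forall x in S, forall y in S, (f x == f y) ==> (x == y)],
        f @: S == T &
        [forall x in S, forall y in S, ((x, y) \in E) == ((f x, f y) \in E)]]].

(* i_k(G): the number of isomorphism classes of k-vertex induced subgraphs,
   i.e. the number of classes of k-subsets of vertices under induced_iso. *)
Definition ik (n : nat) (E : {set 'I_n * 'I_n}) (k : nat) : nat :=
  #|[set [set T : {set 'I_n} | (#|T| == k) && induced_iso E S T]
     | S in [set S : {set 'I_n} | #|S| == k]]|.

Arguments gnp_prob {R} n p A.
Arguments ik {n} E k.
Arguments induced_iso {n} E S T.
Arguments simple_graph {n} E.
Arguments nedges {n} E.

(* Main.v *)
(* Write x = n/k, so that d >= x^2. If ln x is below a large absolute constant,
   the base of the claimed bound is less than 1; otherwise it suffices to show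
   i_k > x^(k/8). Take a set A of few vertices and a set T of linear size,
   disjoint from A, whose vertices have pairwise distinct neighbourhoods in A.
   For B in T with |A| + |B| = k, an isomorphism from G[A + B] onto a fixed
   graph is determined, as far as B is concerned, by its restriction to A. Hence
   i_k >= C(|T|, k - |A|) / L, where L bounds the number of possible restrictions.

   If p > n^(-11/25), let A be any set of about k ln x / (8 ln n) vertices: all
   vertices outside A have distinct neighbourhoods in A, and L = n^|A| is good
   enough. If p <= n^(-11/25), restrict to vertices of degree O(d); as any two
   disjoint sets of s = k ln x / (40 ln(8d)) vertices are joined by an edge, there
   is a connected A with 5s such vertices, so that L = n (8d)^|A|. All but 10s
   vertices have five neighbours in A, and at most four of them share the same
   neighbourhood, since there is no K_{5,5}. *)
Require Import Defs.
From HB Require Import structures.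
From mathcomp Require Import all_boot all_order all_algebra.
From mathcomp Require Import all_classical all_reals all_analysis.
From mathcomp Require Import ring lra zify.
Import Order.TTheory GRing.Theory Num.Theory.
Import numFieldNormedType.Exports.
Local Open Scope ring_scope.

(** * Isomorphic induced subgraphs and the basic lower bound for [ik] *)

Lemma fiber_card_le (aT rT : finType) (h : aT -> rT) (D : {set aT}) (m : nat) :
  (forall y, y \in h @: D -> (#|[set x in D | h x == y]| <= m)%N) ->
  (#|D| <= #|h @: D| * m)%N.
Proof.
move=> hm; rewrite -sum1_card (partition_big_imset h) /= -sum_nat_const.
apply: leq_sum => y yD; apply: leq_trans (hm y yD).
by rewrite -sum1_card; apply: eq_leq; apply: eq_bigl => x; rewrite !inE.
Qed.

Lemma induced_iso_refl {n : nat} (E : {set 'I_n * 'I_n}) (S : {set 'I_n}) :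
  induced_iso E S S.
Proof.
apply/existsP; exists [ffun x => x]; apply/and3P; split.
- apply/forall_inP => x _; apply/forall_inP => y _; apply/implyP.
  by rewrite !ffunE.
- apply/eqP/setP => x; apply/imsetP/idP => [[y yS ->]|xS].
    by rewrite ffunE.
  by exists x; rewrite ?ffunE.
- by apply/forall_inP => x _; apply/forall_inP => y _; rewrite !ffunE.
Qed.

Definition is_iso {n : nat} (E : {set 'I_n * 'I_n}) (S T : {set 'I_n})
    (f : {ffun 'I_n -> 'I_n}) : Prop :=
  [/\ {in S &, injective f}, f @: S = T &
      {in S &, forall x y, ((x, y) \in E) = ((f x, f y) \in E)}].

Lemma induced_isoP {n : nat} (E : {set 'I_n * 'I_n}) (S T : {set 'I_n}) :
  induced_iso E S T -> exists f, is_iso E S T f.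
Proof.
case/existsP => f /and3P[/forall_inP f1 /eqP f2 /forall_inP f3].
exists f; split => // x y xS yS.
  by move=> /eqP fxy; move/forall_inP: (f1 x xS) => /(_ y yS) /implyP /(_ fxy) /eqP.
by move/forall_inP: (f3 x xS) => /(_ y yS) /eqP.
Qed.

(* Once the images of the vertices of w are known, B can be recovered as the
   set of vertices of T whose neighbourhood in w is the preimage of a
   neighbourhood in the image of w. *)
Lemma ik_lower {n : nat} (E : {set 'I_n * 'I_n}) (k : nat) (w : seq 'I_n)
    (T U : {set 'I_n}) (L : seq (seq 'I_n)) :
  uniq w -> [disjoint w & T] -> (size w <= k)%N ->
  {subset w <= U} -> T \subset U ->
  {in T &, forall b b',
     (forall a, a \in w -> ((a, b) \in E) = ((a, b') \in E)) -> b = b'} ->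
  (forall f : 'I_n -> 'I_n, {in w, forall x, f x \in U} ->
     {in w &, forall x y, ((x, y) \in E) = ((f x, f y) \in E)} ->
     map f w \in L) ->
  ('C(#|T|, k - size w) <= ik E k * size L)%N.
Proof.
move=> uw wT wk wU TU injT hL.
pose A := [set x in w].
have AT : [disjoint A & T] by rewrite (eq_disjoint (B:=mem w)) // => x; rewrite inE.
have cA : #|A| = size w by rewrite cardsE; apply/card_uniqP.
pose cls S := [set T0 : {set 'I_n} | (#|T0| == k) && induced_iso E S T0].
pose D := [set B : {set 'I_n} | B \subset T & #|B| == (k - size w)%N].
pose h (B : {set 'I_n}) := cls (A :|: B).
have cAB B : B \in D -> #|A :|: B| = k.
  rewrite inE => /andP[BT /eqP cB]; rewrite cardsU cA cB.
  suff -> : A :&: B = finset.set0 by rewrite cards0 subn0 subnKC.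
  by apply/eqP; rewrite finset.setI_eq0; apply: disjointWr AT.
have -> : 'C(#|T|, k - size w) = #|D| by rewrite -cards_draws.
have hD : (#|h @: D| <= ik E k)%N.
  apply: subset_leq_card; apply/fintype.subsetP => c /imsetP[B BD ->].
  by apply/imsetP; exists (A :|: B); rewrite // inE cAB.
(* It remains to bound each fibre of [h] by [size L]: the sets [B] for which [A :|: B] lies in the
   class of a fixed [A :|: B0]. *)
apply: leq_trans (leq_mul hD (leqnn _)); apply: fiber_card_le => c.
case/imsetP => B0 B0D ->.
pose F := [set x in D | h x == h B0].
have isoF B : B \in F -> exists f, is_iso E (A :|: B) (A :|: B0) f.
  rewrite inE => /andP[BD /eqP hB]; apply: induced_isoP.
  have : A :|: B0 \in h B0 by rewrite inE cAB // eqxx induced_iso_refl.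
  by rewrite -hB inE => /andP[].
(* One isomorphism is fixed for each [B], so that [map (fi B) w] is a function of [B], which will be
   injective on [F]. *)
have {isoF} isoF : exists fi : {set 'I_n} -> {ffun 'I_n -> 'I_n}, forall B, B \in F ->
    is_iso E (A :|: B) (A :|: B0) (fi B).
  suff /boolp.choice[fi hfi] : forall B, exists f, B \in F -> is_iso E (A :|: B) (A :|: B0) f by exists fi.
  move=> B.
  case: (boolP (B \in F)) => [/isoF[f hf]|_]; first by exists f.
  by exists [ffun x => x].
case: isoF => fi isoF.
have FT B : B \in F -> B \subset T by rewrite !inE => /andP[/andP[]].
have key B B' : B \in F -> B' \in F ->
    {in w, fi B =1 fi B'} -> B \subset B'.
  move=> BF B'F eqw; apply/fintype.subsetP => b bB.
  have [i1 i2 i3] := isoF B BF; have [j1 j2 j3] := isoF B' B'F.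
  have bAB : b \in A :|: B by rewrite inE bB orbT.
  have : fi B b \in A :|: B0 by rewrite -i2 imset_f.
  (* [b'] is the vertex that [fi B'] sends to the image of [b]. It is not in [A], where the two maps
     agree and injectivity of [fi B] would force [b = b']; so it lies in [B']. Both vertices then
     see [w] alike and coincide by [injT]. *)
  rewrite -j2 => /imsetP[b' b'AB' eb].
  have bT := fintype.subsetP (FT _ BF) _ bB.
  have bA : b \notin A by rewrite (disjointFl AT).
  have wA a : a \in w -> a \in A by rewrite inE.
  have b'A : b' \notin A.
    apply/negP => b'A; have b'w : b' \in w by rewrite inE in b'A.
    move: eb; rewrite -eqw // => /i1 e; move: bA; rewrite e ?b'A //.
    by rewrite inE b'A.
  have b'B' : b' \in B' by move: b'AB'; rewrite inE (negbTE b'A).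
  suff -> : b = b' by [].
  apply: injT => //; first exact: fintype.subsetP (FT _ B'F) _ b'B'.
  move=> a aw; have aA := wA a aw.
  have aAB : a \in A :|: B by rewrite finset.in_setU aA.
  have aAB' : a \in A :|: B' by rewrite finset.in_setU aA.
  by rewrite (i3 _ _ aAB bAB) (j3 _ _ aAB' b'AB') eb eqw.
have injF : {in F &, injective (fun B => map (fi B) w)}.
  move=> B B' BF B'F /eq_in_map e; apply/eqP; rewrite finset.eqEsubset !key //.
  by move=> x xw /=; rewrite e.
rewrite cardE -(size_map (fun B => map (fi B) w)).
apply: uniq_leq_size.
  rewrite map_inj_in_uniq ?enum_uniq // => B B'; rewrite !mem_enum; exact: injF.
move=> s /mapP[B]; rewrite mem_enum => BF ->.
have [i1 i2 i3] := isoF B BF.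
have B0T : B0 \subset T by move: B0D; rewrite inE => /andP[].
apply: hL.
  move=> x xw; have : fi B x \in A :|: B0 by rewrite -i2 imset_f // !inE xw.
  rewrite !inE => /orP[/wU //|xB]; apply: (fintype.subsetP TU); exact: (fintype.subsetP B0T).
by move=> x y xw yw; apply: i3; rewrite !inE ?xw ?yw.
Qed.

Lemma subset_of_card {T : finType} (A : {set T}) (m : nat) :
  (m <= #|A|)%N -> exists2 B : {set T}, B \subset A & #|B| = m.
Proof.
move=> mA; have : (0 < #|[set B : {set T} | B \subset A & #|B| == m]|)%N.
  by rewrite cards_draws bin_gt0.
by case/card_gt0P => B; rewrite inE => /andP[BA /eqP cB]; exists B.
Qed.

Lemma injective_section {aT rT : finType} (h : aT -> rT) (D : {set aT}) :
  exists T : {set aT}, [/\ T \subset D, {in T &, injective h} & h @: T = h @: D].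
Proof.
have [->|[b0 b0D]] := set_0Vmem D.
  exists finset.set0; split; rewrite ?finset.sub0set // => x y; by rewrite inE.
pose r y := odflt b0 [pick b in D | h b == y].
have rP y : y \in h @: D -> r y \in D /\ h (r y) = y.
  case/imsetP => b bD ->; rewrite /r; case: pickP => [c /andP[cD /eqP ec]|/(_ b)] //=.
  by rewrite bD eqxx.
exists (r @: (h @: D)); split.
- by apply/fintype.subsetP => b /imsetP[y yD ->]; case: (rP y yD).
- move=> b b' /imsetP[y yD ->] /imsetP[y' y'D ->].
  by rewrite (rP y yD).2 (rP y' y'D).2 => ->.
- apply/setP => y; apply/imsetP/idP => [[b /imsetP[z zD ->] ->]|yD].
    by rewrite (rP z zD).2.
  by exists (r y); [apply: imset_f | rewrite (rP y yD).2].
Qed.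

(** * Connected vertex sets and their possible images *)

(** The root comes last in the list and every other entry has a neighbour further down, so the list
    records a connected set in reverse order of growth. *)
Fixpoint tree_seq {n : nat} (E : {set 'I_n * 'I_n}) (V : {set 'I_n})
    (w : seq 'I_n) : bool :=
  if w is y :: w' then
    [&& y \in V, y \notin w', (w' == [::]) || has (fun x => (x, y) \in E) w'
      & tree_seq E V w']
  else true.

Lemma tree_seq_sub {n : nat} (E : {set 'I_n * 'I_n}) (V : {set 'I_n}) w :
  tree_seq E V w -> {subset w <= V}.
Proof.
elim: w => //= y w IH /and4P[yV _ _ /IH sw] x; rewrite inE.
by case/orP => [/eqP -> // |/sw].
Qed.

Lemma tree_seq_uniq {n : nat} (E : {set 'I_n * 'I_n}) (V : {set 'I_n}) w :
  tree_seq E V w -> uniq w.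
Proof. by elim: w => //= y w IH /and4P[_ -> _ /IH]. Qed.

(* Reading w from its root, each further vertex is sent to one of the at most
   Delta neighbours of the image of its parent. *)
Lemma tree_seq_images {n : nat} (E : {set 'I_n * 'I_n}) (V : {set 'I_n})
    (Delta : nat) (w : seq 'I_n) :
  {in V, forall x, #|[set y in V | (x, y) \in E]| <= Delta}%N ->
  tree_seq E V w -> w != [::] ->
  exists L : seq (seq 'I_n),
    [/\ (size L <= n * Delta ^ (size w).-1)%N,
        {in L, forall t, size t = size w /\ {subset t <= V}} &
        forall f : 'I_n -> 'I_n, {in w, forall x, f x \in V} ->
          {in w &, forall x y, ((x, y) \in E) = ((f x, f y) \in E)} ->
          map f w \in L].
Proof.
move=> degV; elim: w => // y w IH /= /and4P[yV yw par tw] _.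
have [w0|wN0] := eqVneq w [::].
  rewrite w0; exists [seq [:: x] | x <- enum V]; split.
  - rewrite size_map -cardE expn0 muln1.
    by rewrite -[X in (_ <= X)%N]card_ord max_card.
  - move=> t /mapP[x]; rewrite mem_enum => xV ->; split => // z.
    by rewrite inE => /eqP ->.
  - move=> f fV _; apply/mapP; exists (f y) => //.
    by rewrite mem_enum fV // inE.
have [L [sL LV Lf]] := IH tw wN0.
move: par; rewrite (negbTE wN0) /= => /hasP[x xw xy].
have iw : (index x w < size w)%N by rewrite index_mem.
(* Candidates for the image of [y] when [t] lists the images of [w]: the neighbours in [V] of the
   image of the parent [x], which sits in [t] at the position of [x] in [w]. *)
pose N (t : seq 'I_n) := [set y' in V | (nth y t (index x w), y') \in E].
exists [seq y' :: t | t <- L, y' <- enum (N t)]; split.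
- rewrite size_allpairs_dep.
  have -> : (size w = (size w).-1.+1)%N by case: (w) wN0.
  rewrite expnS mulnCA mulnC; apply: leq_trans (leq_mul sL (leqnn _)).
  have : {in L, forall t, size (enum (N t)) <= Delta}%N.
    move=> t /LV[st tV]; rewrite -cardE; apply: degV; apply: tV.
    by apply: mem_nth; rewrite st.
  elim: (L) => //= t l IHl hl; rewrite mulSn leq_add //.
    by apply: hl; rewrite inE eqxx.
  by apply: IHl => u ul; apply: hl; rewrite inE ul orbT.
- move=> u /allpairsPdep[t [y' [tL + ->]]]; rewrite mem_enum inE => /andP[y'V _].
  have [<- tV] := LV t tL; split => // z; rewrite inE => /orP[/eqP -> //|].
  exact: tV.
- move=> f fV fE.
  have sw z : z \in w -> z \in y :: w by rewrite inE => ->; rewrite orbT.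
  apply/allpairsPdep; exists (map f w), (f y); split => //.
    apply: Lf => [z /sw/fV //|z z' /sw zw /sw z'w]; exact: fE.
  rewrite mem_enum inE fV ?inE ?eqxx //=.
  by rewrite (nth_map y) // nth_index // -(fE _ _ (sw _ xw) (mem_head y w)).
Qed.

(* Remove a largest union of components of size less than s; a component of
   the rest with fewer than m vertices would enlarge it. *)
Lemma tree_seq_exists {n : nat} (E : {set 'I_n * 'I_n}) (V : {set 'I_n})
    (s m : nat) :
  (forall S1 S2 : {set 'I_n}, [disjoint S1 & S2] ->
     (s <= #|S1|)%N -> (s <= #|S2|)%N ->
     exists x y, [/\ x \in S1, y \in S2 & (x, y) \in E]) ->
  (0 < s)%N -> (m + s + s <= #|V|)%N ->
  exists w, tree_seq E V w /\ size w = m.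
Proof.
move=> expE s0 mV.
pose P (U : {set 'I_n}) := [&& U \subset V, (#|U| < s)%N &
  [forall x in U, forall y in V :\: U, (x, y) \notin E]].
have P0 : P finset.set0.
  by rewrite /P finset.sub0set cards0 s0; apply/forall_inP => x; rewrite inE.
have [U /and3P[UV Us /forall_inP Ucl] Umax] := @arg_maxnP _ finset.set0 P (fun U => #|U|) P0.
suff H j : (j <= m)%N -> exists w, tree_seq E (V :\: U) w /\ size w = j.
  have [w [tw sw]] := H m (leqnn _); exists w; split => //.
  elim: w tw {sw} => //= y w IH /and4P[+ -> -> /IH ->].
  by rewrite inE => /andP[_ ->].
elim: j => [|j IH] jm; first by exists [::].
have [w [tw sw]] := IH (ltnW jm).
have wVU := tree_seq_sub _ _ _ tw.
have [w0|wN0] := eqVneq w [::].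
  have : (0 < #|V :\: U|)%N.
    rewrite cardsD (finset.setIidPr UV) subn_gt0.
    by apply: leq_trans Us (leq_trans _ mV); rewrite leq_addl.
  case/card_gt0P => v vVU; exists [:: v]; rewrite /= vVU; split => //.
  by rewrite -sw w0.
pose Y := [set y in V :\: U | (y \notin w) && has (fun x => (x, y) \in E) w].
have [Y0|[y]] := set_0Vmem Y; last first.
  rewrite inE => /and3P[yV yw hy]; exists (y :: w) => /=.
  by rewrite yV yw hy tw orbT sw.
(* No vertex extends [w], so no edge leads from [C] to the rest of [V]. If [C] has fewer than [s]
   vertices it contradicts the maximality of [U]; otherwise [C] and [V :\: C] are two sets of at
   least [s] vertices with no edge between them. *)
pose C := U :|: [set x in w].
have CV : C \subset V.
  apply/fintype.subsetP => x; rewrite !inE => /orP[/(fintype.subsetP UV) //|/wVU].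
  by rewrite inE => /andP[].
have Ccl x y : x \in C -> y \in V :\: C -> (x, y) \notin E.
  rewrite !inE negb_or => xC /andP[/andP[yU yw] yV].
  case/orP: xC => [xU|xw].
    by move/forall_inP: (Ucl x xU); apply; rewrite inE yU.
  apply/negP => xy; suff : y \in Y by rewrite Y0 inE.
  rewrite !inE yU yV yw /=; apply/hasP; by exists x.
have cC : (#|C| <= #|U| + j)%N.
  apply: leq_trans (leq_card_setU _ _).1 _; rewrite leq_add2l -sw cardsE.
  exact: card_size.
have [sC|Cs] := leqP s #|C|; last first.
  have PC : P C.
    by rewrite /P CV Cs; apply/forall_inP => x xC; apply/forall_inP => y; apply: Ccl.
  have /(_ C PC) := Umax => /=.
  have [x xw] : exists x, x \in w.
    by case: (w) wN0 => // x l _; exists x; rewrite inE eqxx.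
  have : U \proper C.
    apply/properP; split; first exact: finset.subsetUl.
    exists x; first by rewrite !inE xw orbT.
    by have := wVU x xw; rewrite inE => /andP[].
  by move/proper_card => UC /(leq_trans UC); rewrite ltnn.
have [||x [y [xC yC]]] := expE C (V :\: C) _ sC.
- by rewrite disjoint_sym finset.disjoints_subset finset.setDE finset.subsetIr.
- by rewrite cardsD (finset.setIidPr CV); lia.
by rewrite (negbTE (Ccl x y xC yC)).
Qed.

(** * Separating neighbourhoods and deterministic lower bounds for [ik] *)

(** [w] is cut into five blocks of [s] vertices. At most [s] vertices of [V] outside [w] have no
    neighbour in a given block; discarding these and [w] itself costs at most [10 * s] vertices and
    leaves vertices with a neighbour in each block. Five of them with equal neighbourhoods would
    yield a K_{5,5}, hence the factor 4. *)
Lemma distinct_neighbourhoods {n : nat} (E : {set 'I_n * 'I_n})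
    (V : {set 'I_n}) (s : nat) (w : seq 'I_n) :
  (forall S1 S2 : {set 'I_n}, [disjoint S1 & S2] ->
     (s <= #|S1|)%N -> (s <= #|S2|)%N ->
     exists x y, [/\ x \in S1, y \in S2 & (x, y) \in E]) ->
  (forall X Y : {set 'I_n}, [disjoint X & Y] -> #|X| = 5 -> #|Y| = 5 ->
     exists x y, [/\ x \in X, y \in Y & (x, y) \notin E]) ->
  uniq w -> {subset w <= V} -> size w = (5 * s)%N ->
  exists T : {set 'I_n},
    [/\ T \subset V, [disjoint w & T], (#|V| <= 10 * s + 4 * #|T|)%N &
       {in T &, forall b b',
         (forall a, a \in w -> ((a, b) \in E) = ((a, b') \in E)) -> b = b'}].
Proof.
move=> expE noK uw wV sw.
pose A := [set x in w].
have cA : #|A| = (5 * s)%N by rewrite cardsE -sw; apply/card_uniqP.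
have AV : A \subset V by apply/fintype.subsetP => x; rewrite inE => /wV.
pose P (i : 'I_5) := [set x in take s (drop (i * s) w)].
have PA i : P i \subset A.
  by apply/fintype.subsetP => x; rewrite !inE => /mem_take /mem_drop.
have cP i : #|P i| = s.
  rewrite cardsE (card_uniqP _) ?take_uniq ?drop_uniq // size_takel //.
  by rewrite size_drop sw; case: i => i /= i5; nia.
have PI (i j : 'I_5) x : x \in P i -> x \in P j -> i = j.
  (* The position of a vertex in [w] tells its block, because [w] is duplicate-free; hence the
     blocks are disjoint. *)
  have aux (k : 'I_5) : x \in P k -> (k * s <= index x w < k.+1 * s)%N.
    rewrite inE => xk; have xd := mem_take xk.
    have dr : drop (k * s) w = take s (drop (k * s) w) ++ drop s (drop (k * s) w).
      by rewrite cat_take_drop.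
    have wk : w = take (k * s) w ++ drop (k * s) w by rewrite cat_take_drop.
    have xt : x \notin take (k * s) w.
      have := uw; rewrite {1}wk cat_uniq => /and3P[_ /hasPn/(_ x xd) //].
    rewrite {1 2}wk index_cat (negbTE xt) size_takel; last first.
      by rewrite sw leq_mul2r; case: (k) => /= r r5; rewrite (ltnW r5) orbT.
    rewrite leq_addr /= mulSn addnC ltn_add2r dr index_cat xk.
    apply: leq_trans (_ : size (take s (drop (k * s) w)) <= _)%N; first by rewrite index_mem.
    by rewrite size_take; case: ltnP.
  move=> /aux /andP[i1 i2] /aux /andP[j1 j2]; apply/val_inj => /=; nia.
pose bad i := [set b in V :\: A | [forall a in P i, (a, b) \notin E]].
have cbad i : (#|bad i| <= s)%N.
  rewrite leqNgt; apply/negP => /ltnW sb.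
  have [||x [y [xP yb xy]]] := expE (P i) (bad i) _ _ sb; last 1 first.
  - move: yb; rewrite inE => /andP[_ /forall_inP/(_ x xP)]; by rewrite xy.
  - rewrite disjoint_subset; apply/fintype.subsetP => x /(fintype.subsetP (PA i)) xA.
    by rewrite inE /= inE inE xA.
  - by rewrite cP.
pose G := (V :\: A) :\: \bigcup_i bad i.
have cG : (#|V| <= 10 * s + #|G|)%N.
  have c1 : (#|\bigcup_i bad i| <= 5 * s)%N.
    apply: leq_trans (_ : \sum_(i < 5) #|bad i| <= _)%N.
      elim/big_ind2: _ => [|B1 x1 B2 x2 h1 h2|//]; first by rewrite cards0.
      by apply: leq_trans (leq_card_setU _ _).1 _; apply: leq_add.
    apply: leq_trans (_ : \sum_(i < 5) s <= _)%N; first exact: leq_sum.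
    by rewrite sum_nat_const card_ord.
  have c2 : (#|V| = #|V :&: A| + #|V :\: A|)%N by rewrite cardsID.
  have c3 : (#|V :\: A| = #|(V :\: A) :&: \bigcup_i bad i| + #|G|)%N by rewrite cardsID.
  have c4 : (#|V :&: A| <= 5 * s)%N by rewrite -cA subset_leq_card // finset.subsetIr.
  have c5 : (#|(V :\: A) :&: \bigcup_i bad i| <= 5 * s)%N.
    by apply: leq_trans c1; rewrite subset_leq_card // finset.subsetIr.
  rewrite c2 c3; move: c4 c5.
  move: #|V :&: A| #|_ :&: _| #|G| => u v g; lia.
pose N b := [set a in A | (a, b) \in E].
have cN b : b \in G -> (5 <= #|N b|)%N.
  rewrite inE => /andP[nb bVA].
  have ex i : exists a, (a \in P i) && ((a, b) \in E).
    move: nb => /bigcupP nb; apply/existsP; apply: contra_notT nb.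
    rewrite negb_exists => /forallP h; exists i => //.
    rewrite inE bVA; apply/forall_inP => a aP; have := h a.
    by rewrite negb_and aP.
  pose g i := xchoose (ex i).
  have gP i : (g i \in P i) /\ ((g i, b) \in E) by apply/andP; apply: (xchooseP (ex i)).
  have injg : injective g.
    by move=> i j gij; apply: (PI i j (g i)); rewrite ?(gP i).1 // gij (gP j).1.
  rewrite -[5%N]card_ord -cardsT -(card_imset _ injg); apply: subset_leq_card.
  apply/fintype.subsetP => a /imsetP[i _ ->]; rewrite inE (gP i).2 andbT.
  exact: (fintype.subsetP (PA i)) (gP i).1.
have [T [TG injT imT]] := injective_section N G.
have GVA : G \subset V :\: A := finset.subsetDl _ _.
have TVA := fintype.subset_trans TG GVA.
exists T; split.
- exact: fintype.subset_trans TVA (finset.subsetDl _ _).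
- rewrite disjoint_sym disjoint_subset; apply/fintype.subsetP => x /(fintype.subsetP TVA).
  by rewrite !inE => /andP[].
- apply: leq_trans cG _; rewrite leq_add2l mulnC.
  rewrite -(card_in_imset injT) imT; apply: fiber_card_le => y /imsetP[b0 b0G ->].
  rewrite leqNgt; apply/negP => /subset_of_card[Y YF cY].
  have [X XN cX] := subset_of_card _ _ (cN b0 b0G).
  have [|x [z [xX zY]]] := noK X Y _ cX cY.
    rewrite disjoint_subset; apply/fintype.subsetP => x /(fintype.subsetP XN).
    rewrite inE => /andP[xA _]; apply/negP => /(fintype.subsetP YF).
    rewrite inE => /andP[/(fintype.subsetP GVA)]; by rewrite inE xA.
  have := fintype.subsetP YF z zY; rewrite inE => /andP[_ /eqP Nz].
  by have := fintype.subsetP XN x xX; rewrite -Nz inE => /andP[_ ->].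
- move=> b b' bT b'T h; apply: injT => //; apply/setP => a; rewrite !inE.
  by case: (boolP (a \in w)) => //= /h ->.
Qed.

Lemma ik_lower_fixed_set {n : nat} (E : {set 'I_n * 'I_n}) (k : nat) (w : seq 'I_n) :
  uniq w -> (size w <= k)%N ->
  (forall b b', b \notin w -> b' \notin w ->
     (forall a, a \in w -> ((a, b) \in E) = ((a, b') \in E)) -> b = b') ->
  ('C(n - size w, k - size w) <= ik E k * n ^ size w)%N.
Proof.
move=> uw wk sep.
pose T := [set b : 'I_n | b \notin w].
have cT : #|T| = (n - size w)%N.
  have -> : T = ~: [set x in w] by apply/setP => x; rewrite !inE.
  by rewrite cardsCs finset.setCK card_ord cardsE (card_uniqP uw).
have -> : (n ^ size w)%N = size (map (@tval (size w) _) (enum {: (size w).-tuple 'I_n})).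
  by rewrite size_map -cardE card_tuple card_ord.
rewrite -cT; apply: (ik_lower E k w T finset.setT) => //.
- by rewrite disjoint_sym disjoint_subset; apply/fintype.subsetP => x; rewrite inE.
- by apply/fintype.subsetP.
- by move=> b b'; rewrite !inE; exact: sep.
- move=> f _ _; have st : size (map f w) == size w by rewrite size_map.
  by apply/mapP; exists (Tuple st); rewrite ?mem_enum ?inE.
Qed.

Section SimpleGraph.
Context {n : nat} {E : {set 'I_n * 'I_n}} (sgE : simple_graph E).

Lemma simple_graph_irr x : (x, x) \notin E.
Proof. by case/andP: sgE => /forallP. Qed.

Lemma simple_graph_sym x y : ((x, y) \in E) = ((y, x) \in E).
Proof. by case/andP: sgE => _ /forallP /(_ x) /forallP /(_ y) /eqP. Qed.

Lemma sum_degrees : (\sum_x #|[set y | (x, y) \in E]| = 2 * nedges E)%N.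
Proof.
have -> : (\sum_x #|[set y | (x, y) \in E]| = #|E|)%N.
  transitivity (\sum_x \sum_(y | (x, y) \in E) 1)%N.
    by apply: eq_bigr => x _; rewrite sum1_card cardsE.
  by rewrite pair_big_dep -sum1_card; apply: eq_bigl => -[x y].
pose E1 := [set e in E | (e.1 < e.2)%N]; pose sw (e : 'I_n * 'I_n) := (e.2, e.1).
have swK : involutive sw by case.
have eE : E = E1 :|: sw @: E1.
  apply/setP => -[x y]; rewrite !inE /=; apply/idP/idP => [xy|/orP[/andP[]//|]].
    case: (ltngtP x y) => [xy1|yx|/val_inj exy]; first by rewrite xy.
    - rewrite xy /=; apply/imsetP; exists (y, x) => //.
      by rewrite inE /= yx andbT -simple_graph_sym.
    - by have := simple_graph_irr x; rewrite {2}exy xy.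
  by case/imsetP => -[u v]; rewrite inE => /andP[+ _] [-> ->]; rewrite simple_graph_sym.
rewrite {1}eE cardsU card_imset; last exact: inv_inj.
suff -> : E1 :&: sw @: E1 = finset.set0 by rewrite cards0 subn0 mul2n -addnn.
apply/eqP; rewrite finset.setI_eq0; apply/pred0P => -[x y] /=.
apply/negP => /andP[]; rewrite inE => /andP[_ /= xy] /imsetP[[u v]].
by rewrite inE => /andP[_ /= uv] [ex ey]; move: xy; rewrite ex ey ltnNge ltnW.
Qed.

Lemma many_small_degrees (Delta : nat) :
  (4 * nedges E <= n * Delta.+1)%N ->
  (n <= 2 * #|[set x | #|[set y | (x, y) \in E]| <= Delta]|)%N.
Proof.
move=> eD; set V := [set x | _].
have : (#|~: V| * Delta.+1 <= 2 * nedges E)%N.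
  rewrite -sum_degrees -sum_nat_const [X in (_ <= X)%N](bigID (fun x => x \in ~: V)) /=.
  apply: (leq_trans _ (leq_addr _ _)); apply: leq_sum => x.
  by rewrite !inE -ltnNge.
have := cardsC V; rewrite card_ord.
move: #|V| #|~: V| => u v; nia.
Qed.

Lemma ik_lower_sparse (k s Delta : nat) :
  (forall S1 S2 : {set 'I_n}, [disjoint S1 & S2] -> #|S1| = s -> #|S2| = s ->
     exists x y, [/\ x \in S1, y \in S2 & (x, y) \in E]) ->
  (forall X Y : {set 'I_n}, [disjoint X & Y] -> #|X| = 5 -> #|Y| = 5 ->
     exists x y, [/\ x \in X, y \in Y & (x, y) \notin E]) ->
  (4 * nedges E <= n * Delta.+1)%N -> (0 < Delta)%N -> (0 < s)%N ->
  (40 * s <= n)%N -> (5 * s <= k)%N ->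
  exists M, (n <= 16 * M)%N /\ ('C(M, k - 5 * s) <= ik E k * (n * Delta ^ (5 * s)))%N.
Proof.
move=> expE noK eD D0 s0 sn sk.
have expE' (S1 S2 : {set 'I_n}) : [disjoint S1 & S2] ->
    (s <= #|S1|)%N -> (s <= #|S2|)%N ->
    exists x y, [/\ x \in S1, y \in S2 & (x, y) \in E].
  move=> dS /subset_of_card[S1' S1s c1] /subset_of_card[S2' S2s c2].
  have [|x [y [xS yS xy]]] := expE S1' S2' _ c1 c2.
    exact: disjointWl S1s (disjointWr S2s dS).
  by exists x, y; split; rewrite ?(fintype.subsetP S1s) ?(fintype.subsetP S2s).
have := many_small_degrees Delta eD; set V := [set x | _] => cV.
have [|w [tw sw]] := tree_seq_exists E V s (5 * s) expE' s0.
  by move: cV sn s0; clear; set v := #|V|; lia.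
have uw := tree_seq_uniq _ _ _ tw; have wV := tree_seq_sub _ _ _ tw.
have [T [TV wT cT sep]] := distinct_neighbourhoods E V s w expE' noK uw wV sw.
have degV : {in V, forall x, #|[set y in V | (x, y) \in E]| <= Delta}%N.
  move=> x; rewrite inE; apply: leq_trans; apply: subset_leq_card.
  by apply/fintype.subsetP => y; rewrite !inE => /andP[].
have wN0 : w != [::] by rewrite -size_eq0 sw; lia.
have [L [sL _ LE]] := tree_seq_images E V Delta w degV tw wN0.
(* Here n <= 2 |V| <= 20 s + 8 |T|, and 20 s <= n / 2. *)
exists #|T|; split; first by have := leq_trans cV (leq_mul (leqnn 2) cT); move: sn; set t := #|T|; lia.
rewrite -sw; apply: leq_trans (ik_lower E k w T V L uw wT _ wV TV sep LE) _.
  by rewrite sw.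
rewrite leq_mul2l; apply/orP; right; apply: leq_trans sL _.
by rewrite leq_mul2l leq_pexp2l ?orbT // leq_pred.
Qed.

End SimpleGraph.

(** * Random subsets with independent elements *)

Section ProductMeasure.
Context {R : realType} {T : finType}.
Implicit Types (P J Y Z : {set T}) (p : R).

Lemma sum_subset_prod P (F G : T -> R) :
  \sum_(J : {set T} | J \subset P) \prod_(e in J) F e * \prod_(e in P :\: J) G e =
  \prod_(e in P) (F e + G e).
Proof.
(* The extension by 0 and 1 outside [P] makes the subsets not contained in [P] contribute nothing
   when the product is expanded. *)
pose F' e := if e \in P then F e else 0; pose G' e := if e \in P then G e else 1.
transitivity (\prod_e (F' e + G' e)); last first.
  rewrite [RHS]big_mkcond /=; apply: eq_bigr => e _; rewrite /F' /G'.
  by case: ifP => // _; rewrite add0r.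
rewrite bigA_distr [LHS]big_mkcond /=; apply: eq_bigr => J _.
case: ifPn => [JP|/fintype.subsetPn[e eJ eP]]; last first.
  by rewrite (bigD1 e) //= eJ /F' (negbTE eP) mul0r.
rewrite [RHS](bigID (mem J)) /= big_mkcond [in RHS]big_mkcond /=; congr (_ * _).
  apply: eq_bigr => e _; case: ifPn => // eJ.
  by rewrite /F' (fintype.subsetP JP).
rewrite big_mkcond [in RHS]big_mkcond /=; apply: eq_bigr => e _.
by rewrite inE /G'; case: (e \in J) => //=; case: ifP.
Qed.

(** For [J \subset P], the probability that a random subset of [P], keeping each element
    independently with probability [p], equals [J]. *)
Definition bern_wt P p J : R := p ^+ #|J| * (1 - p) ^+ #|P :\: J|.

Lemma bern_wt_ge0 P p J : 0 <= p <= 1 -> 0 <= bern_wt P p J.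
Proof. by case/andP => p0 p1; rewrite mulr_ge0 // exprn_ge0 // subr_ge0. Qed.

(** The condition is absorbed into the weights: the factor [p] becomes 0 on [Z] and the factor
    [1 - p] becomes 0 on [Y], after which the sum factorises over [P]. *)
Lemma bern_cylinder P p Y Z : Y \subset P -> Z \subset P -> [disjoint Y & Z] ->
  \sum_(J : {set T} | J \subset P)
     bern_wt P p J * ((Y \subset J) && [disjoint Z & J])%:R =
  p ^+ #|Y| * (1 - p) ^+ #|Z|.
Proof.
move=> YP ZP YZ.
transitivity (\prod_(e in P) ((if e \in Z then 0 else p) +
                              (if e \in Y then 0 else 1 - p))).
  rewrite -sum_subset_prod; apply: eq_bigr => J JP.
  rewrite /bern_wt; have [YJ|/fintype.subsetPn[e eY eJ]] := boolP (Y \subset J); last first.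
    rewrite mulr0 [X in _ * X](bigD1 e) /=; last by rewrite inE eJ (fintype.subsetP YP).
    by rewrite eY mul0r mulr0.
  have [ZJ|/pred0Pn[e /andP[/= eZ eJ]]] := boolP [disjoint Z & J]; last first.
    by rewrite mulr0 (bigD1 e) //= eZ !mul0r.
  rewrite mulr1; congr (_ * _).
    rewrite (eq_bigr (fun=> p)) ?prodr_const // => e eJ.
    by rewrite (disjointFl ZJ).
  rewrite (eq_bigr (fun=> 1 - p)) ?prodr_const // => e.
  rewrite inE => /andP[eJ _]; case: ifP => // eY.
  by rewrite (fintype.subsetP YJ) in eJ.
rewrite (bigID (mem Y)) /=; congr (_ * _).
  rewrite -prodr_const [RHS]big_mkcond [LHS]big_mkcond /=; apply: eq_bigr => e _.
  case: ifPn => [/andP[eP eY]|].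
    by rewrite eY (disjointFr YZ) // addr0.
  by rewrite negb_and; case: ifPn => // eY; rewrite (fintype.subsetP YP).
rewrite -prodr_const [RHS]big_mkcond [LHS]big_mkcond /=; apply: eq_bigr => e _.
have [eP|eP] := boolP (e \in P) => /=; last first.
  by case: ifPn => // /(fintype.subsetP ZP); rewrite (negbTE eP).
have [eY|eY] := boolP (e \in Y) => /=; first by rewrite (disjointFr YZ).
by case: ifP => eZ; rewrite ?add0r // addrC subrK.
Qed.

Lemma bern_wt_sum P p : \sum_(J : {set T} | J \subset P) bern_wt P p J = 1.
Proof.
have := bern_cylinder P p finset.set0 finset.set0.
rewrite !finset.sub0set cards0 !expr0 mulr1 => <- //; last first.
  by rewrite -finset.setI_eq0 finset.set0I.
apply: eq_bigr => J _; rewrite finset.sub0set -finset.setI_eq0 finset.set0I eqxx.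
by rewrite mulr1.
Qed.

(** The generating function of the size of the random subset; [c = 2] serves to bound the number of
    edges. *)
Lemma bern_moment P p (c : R) :
  \sum_(J : {set T} | J \subset P) bern_wt P p J * c ^+ #|J| =
  (1 + (c - 1) * p) ^+ #|P|.
Proof.
have -> : 1 + (c - 1) * p = c * p + (1 - p) by ring.
rewrite -prodr_const -(sum_subset_prod P (fun=> c * p) (fun=> 1 - p)).
apply: eq_bigr => J _; rewrite /bern_wt !prodr_const exprMn; ring.
Qed.

End ProductMeasure.

(** * The random graph as a random subset of the increasing pairs *)

Section RandomGraph.
Context {R : realType} {n : nat}.
Implicit Types (E J : {set 'I_n * 'I_n}) (p : R).

(** Each possible edge is represented once, so that the edges become independent elements;
    [sym_graph] restores the symmetric edge set. *)
Definition upper_pairs : {set 'I_n * 'I_n} :=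
  [set e : 'I_n * 'I_n | (e.1 < e.2)%N].

Definition sym_graph J : {set 'I_n * 'I_n} := [set e | (e \in J) || ((e.2, e.1) \in J)].

Definition opair (x y : 'I_n) := if (x < y)%N then (x, y) else (y, x).

Lemma opair_upper x y : x != y -> opair x y \in upper_pairs.
Proof.
by rewrite /opair -val_eqE neq_ltn inE; case: ifP => //= xy /orP[|//].
Qed.

Lemma opair_inj (S1 S2 : {set 'I_n}) : [disjoint S1 & S2] ->
  {in finset.setX S1 S2 &, injective (fun u => opair u.1 u.2)}.
Proof.
move=> dS [x y] [x' y']; rewrite !inE /= => /andP[x1 y2] /andP[x'1 y'2].
have ne z t : z \in S1 -> t \in S2 -> z = t -> False.
  by move=> z1 t2 e; have := disjointFr dS z1; rewrite e t2.
rewrite /opair; case: ifP => _; case: ifP => _ [e1 e2] //.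
- by rewrite e1 e2.
- by case: (ne _ _ x1 y'2 e1).
- by case: (ne _ _ x'1 y2); rewrite e1.
- by rewrite e1 e2.
Qed.

Definition opairs (S1 S2 : {set 'I_n}) : {set 'I_n * 'I_n} :=
  [set opair u.1 u.2 | u in finset.setX S1 S2].

Lemma card_opairs (S1 S2 : {set 'I_n}) : [disjoint S1 & S2] -> #|opairs S1 S2| = (#|S1| * #|S2|)%N.
Proof. by move=> dS; rewrite card_in_imset ?cardsX //; exact: opair_inj. Qed.

Lemma opairs_upper (S1 S2 : {set 'I_n}) : [disjoint S1 & S2] -> opairs S1 S2 \subset upper_pairs.
Proof.
move=> dS; apply/fintype.subsetP => e /imsetP[[x y]]; rewrite inE /= => /andP[x1 y2] ->.
apply: opair_upper; apply/eqP => exy; have := disjointFr dS x1.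
by rewrite exy y2.
Qed.

Lemma mem_sym_graph J x y : J \subset upper_pairs ->
  ((x, y) \in sym_graph J) = (opair x y \in J).
Proof.
move=> JP; have up u v : (u, v) \in J -> (u < v)%N.
  by move/(fintype.subsetP JP); rewrite inE.
rewrite inE /= /opair; case: ifPn => xy.
  by apply/orP/idP => [[//|/up]|->]; [rewrite ltnNge ltnW | left].
by apply/orP/idP => [[/up|//]|->]; [rewrite (negbTE xy) | right].
Qed.

Lemma simple_sym_graph J : J \subset upper_pairs -> simple_graph (sym_graph J).
Proof.
move=> JP; apply/andP; split; apply/forallP => x; last first.
  by apply/forallP => y; rewrite !inE /= orbC.
rewrite !inE /= orbb; apply/negP => /(fintype.subsetP JP).
by rewrite inE /= ltnn.
Qed.

Lemma sym_graphK J : J \subset upper_pairs -> sym_graph J :&: upper_pairs = J.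
Proof.
move=> JP; apply/setP => -[x y]; rewrite !inE /=; apply/andP/idP => [[/orP[//|yx] xy]|xy].
  by have := fintype.subsetP JP _ yx; rewrite inE /= ltnNge ltnW.
by rewrite xy; have := fintype.subsetP JP _ xy; rewrite inE.
Qed.

Lemma sym_graph_upper E : simple_graph E -> sym_graph (E :&: upper_pairs) = E.
Proof.
move=> sE; apply/setP => -[x y]; rewrite !inE /= (simple_graph_sym sE y x).
rewrite -andb_orr; have [xyE|//] := boolP ((x, y) \in E) => /=.
rewrite -neq_ltn; apply/negP => /eqP/val_inj xy.
by have := simple_graph_irr sE x; rewrite {2}xy xyE.
Qed.

Lemma card_upper_pairs : #|upper_pairs| = 'C(n, 2).
Proof.
transitivity (\sum_(y < n) \sum_(x < n | (x < y)%N) 1)%N.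
  rewrite (exchange_big_dep xpredT) //= pair_big_dep -sum1_card.
  by apply: eq_bigl => -[x y]; rewrite inE.
rewrite -bin2_sum big_mkord; apply: eq_bigr => y _.
rewrite (big_ord_narrow_cond (P := xpredT) (F := fun=> 1%N) (ltnW (ltn_ord y))).
by rewrite sum1_card card_ord.
Qed.

Lemma nedges_sym_graph J : J \subset upper_pairs -> nedges (sym_graph J) = #|J|.
Proof.
move=> JP; rewrite /nedges -{2}(sym_graphK J JP); apply: eq_card => e.
by rewrite !inE.
Qed.

(** [sym_graph] is a bijection from the subsets of [upper_pairs] onto the simple graphs, with
    inverse the intersection with [upper_pairs], and the size of the subset is the number of
    edges. *)
Lemma gnp_probE p (A : pred {set 'I_n * 'I_n}) :
  gnp_prob n p A =
  \sum_(J : {set 'I_n * 'I_n} | J \subset upper_pairs)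
     bern_wt upper_pairs p J * (A (sym_graph J))%:R.
Proof.
rewrite /gnp_prob big_mkcondr /=.
rewrite (reindex_onto sym_graph (fun E => E :&: upper_pairs)); last exact: sym_graph_upper.
apply: eq_big => [J|J /andP[_ /eqP JP']].
  apply/andP/idP => [[_ /eqP <-]|JP]; first exact: finset.subsetIr.
  by rewrite simple_sym_graph // sym_graphK.
have JP : J \subset upper_pairs by rewrite -JP' finset.subsetIr.
rewrite /bern_wt nedges_sym_graph // cardsD (finset.setIidPr JP) card_upper_pairs.
by case: ifP; rewrite ?mulr1 ?mulr0.
Qed.

Lemma gnp_prob_le1 p (A : pred {set 'I_n * 'I_n}) : 0 <= p <= 1 -> gnp_prob n p A <= 1.
Proof.
move=> p01; rewrite gnp_probE -[leRHS](bern_wt_sum upper_pairs p); apply: ler_sum => J _.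
apply: ler_piMr; first exact: bern_wt_ge0.
by case: (A _); rewrite ?ler01 ?lexx.
Qed.

(** First-moment bound: [Z] dominates the indicator of the failure of [A], so its expectation bounds
    the failure probability. *)
Lemma gnp_prob_ge p (A : pred {set 'I_n * 'I_n}) (Z : {set 'I_n * 'I_n} -> R) :
  0 <= p <= 1 -> (forall J, 0 <= Z J) ->
  (forall J, J \subset upper_pairs -> ~~ A (sym_graph J) -> 1 <= Z J) ->
  1 - \sum_(J : {set 'I_n * 'I_n} | J \subset upper_pairs) bern_wt upper_pairs p J * Z J
    <= gnp_prob n p A.
Proof.
move=> p01 Z0 AZ; rewrite gnp_probE -[X in X - _](bern_wt_sum upper_pairs p) -sumrB.
apply: ler_sum => J JP; rewrite -[X in X - _]mulr1 -mulrBr.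
apply: ler_wpM2l; first exact: bern_wt_ge0.
have [AJ|AJ] := boolP (A _); first by rewrite lerBlDr lerDl.
by rewrite subr_le0 AZ.
Qed.

End RandomGraph.

(** * Union bounds for the two regimes *)

Section UnionBounds.
Context {R : realType} {n : nat}.
Implicit Types (E J : {set 'I_n * 'I_n}) (p : R).

(** Linearity of expectation, with [bern_cylinder] giving the probability that [Y u] is present and
    [Z u] absent. *)
Lemma bern_union {I : finType} p (Q : pred I) (Y Z : I -> {set 'I_n * 'I_n}) :
  (forall u, Q u ->
     [/\ Y u \subset upper_pairs, Z u \subset upper_pairs & [disjoint Y u & Z u]]) ->
  \sum_(J : {set 'I_n * 'I_n} | J \subset upper_pairs) bern_wt upper_pairs p J *
     (\sum_(u | Q u) ((Y u \subset J) && [disjoint Z u & J])%:R) =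
  \sum_(u | Q u) p ^+ #|Y u| * (1 - p) ^+ #|Z u|.
Proof.
move=> hQ; under eq_bigr do rewrite mulr_sumr.
rewrite exchange_big /=; apply: eq_bigr => u /hQ[YP ZP YZ].
exact: bern_cylinder.
Qed.

Definition card_pair (s : nat) (u : {set 'I_n} * {set 'I_n}) : bool :=
  [&& [disjoint u.1 & u.2], #|u.1| == s & #|u.2| == s].

Lemma sum_card_pair (s : nat) (c : R) : 0 <= c ->
  \sum_(u | card_pair s u) c <= ('C(n, s) ^ 2)%:R * c.
Proof.
move=> c0; rewrite sumr_const -[leLHS]mulr_natl ler_wpM2r // ler_nat.
pose D := [set S : {set 'I_n} | #|S| == s].
have <- : #|finset.setX D D| = ('C(n, s) ^ 2)%N.
  by rewrite cardsX card_draws card_ord mulnn.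
apply: subset_leq_card; apply/fintype.subsetP => -[S1 S2].
by rewrite !inE => /and3P[_ /= -> ->].
Qed.

(* The error terms account for two disjoint s-sets joined by no edge, for a
   K_{5,5}, and, by Markov's inequality for 2^nedges, for more than m edges. *)
Lemma gnp_prob_sparse p (k s Delta m : nat) (A : pred {set 'I_n * 'I_n}) :
  0 <= p <= 1 ->
  (forall E M, (n <= 16 * M)%N ->
     ('C(M, k - 5 * s) <= ik E k * (n * Delta ^ (5 * s)))%N -> A E) ->
  (4 * m <= n * Delta.+1)%N -> (0 < Delta)%N -> (0 < s)%N ->
  (40 * s <= n)%N -> (5 * s <= k)%N ->
  1 - (('C(n, s) ^ 2)%:R * (1 - p) ^+ (s * s) + ('C(n, 5) ^ 2)%:R * p ^+ 25
       + (1 + p) ^+ 'C(n, 2) / 2 ^+ m) <= gnp_prob n p A.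
Proof.
move=> p01 hA mD D0 s0 sn sk.
have p0 : 0 <= p by case/andP: p01.
have q0 : 0 <= 1 - p by rewrite subr_ge0; case/andP: p01.
pose Z1 J : R := \sum_(u | card_pair s u)
  ((finset.set0 \subset J) && [disjoint opairs u.1 u.2 & J])%:R.
pose Z2 J : R := \sum_(u | card_pair 5 u)
  ((opairs u.1 u.2 \subset J) && [disjoint finset.set0 & J])%:R.
pose Z3 J : R := 2 ^+ #|J| / 2 ^+ m.
have Z10 J : 0 <= Z1 J by apply: sumr_ge0.
have Z20 J : 0 <= Z2 J by apply: sumr_ge0.
have Z30 J : 0 <= Z3 J by rewrite divr_ge0 // exprn_ge0.
have term_le (I : finType) (Q F : pred I) (u : I) : Q u -> F u ->
    1 <= \sum_(v | Q v) (F v)%:R :> R.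
  by move=> Qu Fu; rewrite (bigD1 u) //= Fu lerDl sumr_ge0.
have d0 (S : {set 'I_n * 'I_n}) : [disjoint finset.set0 & S].
  by rewrite -finset.setI_eq0 finset.set0I.
apply: le_trans (gnp_prob_ge p A (fun J => Z1 J + Z2 J + Z3 J) p01 _ _); last first.
- move=> J JP; apply: contraNT; rewrite -ltNge => Zlt.
  have b1 : Z1 J < 1 by have := Z20 J; have := Z30 J; move: Zlt; lra.
  have b2 : Z2 J < 1 by have := Z10 J; have := Z30 J; move: Zlt; lra.
  have b3 : Z3 J < 1 by have := Z10 J; have := Z20 J; move: Zlt; lra.
  have [|||M [nM cM]] := ik_lower_sparse (simple_sym_graph J JP) k s Delta _ _ _ D0 s0 sn sk.
  + move=> S1 S2 dS c1 c2; apply: contrapT => hno.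
    suff : 1 <= Z1 J by rewrite leNgt b1.
    apply: (term_le _ _ _ (S1, S2)); rewrite /card_pair /= ?dS ?c1 ?c2 ?eqxx //.
    rewrite finset.sub0set /= disjoint_subset; apply/fintype.subsetP => e.
    case/imsetP => -[x y]; rewrite inE /= => /andP[x1 y2] ->.
    rewrite inE; apply/negP => xyJ; apply: hno; exists x, y.
    by rewrite mem_sym_graph.
  + move=> X Y dS c1 c2; apply: contrapT => hno.
    suff : 1 <= Z2 J by rewrite leNgt b2.
    apply: (term_le _ _ _ (X, Y)); rewrite /card_pair /= ?dS ?c1 ?c2 ?eqxx //.
    rewrite d0 andbT; apply/fintype.subsetP => e.
    case/imsetP => -[x y]; rewrite inE /= => /andP[x1 y2] ->.
    rewrite -mem_sym_graph //; apply/negPn/negP => xyJ; apply: hno.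
    by exists x, y.
  + rewrite nedges_sym_graph //; apply: leq_trans mD; rewrite leq_mul2l /=.
    move: b3; rewrite /Z3 ltr_pdivrMr ?exprn_gt0 // mul1r ltr_eXn2l ?ltr1n //.
    exact: ltnW.
  exact: hA cM.
- by move=> J; rewrite !addr_ge0.
rewrite lerD2l lerN2.
under eq_bigr do rewrite !mulrDr.
rewrite !big_split /=; apply: lerD; first apply: lerD.
- rewrite bern_union => [|u /and3P[du _ _]]; last first.
    by rewrite finset.sub0set opairs_upper.
  apply: le_trans (sum_card_pair s _ (exprn_ge0 _ q0)).
  apply: ler_sum => u /and3P[du /eqP c1 /eqP c2].
  by rewrite cards0 expr0 mul1r card_opairs // c1 c2.
- rewrite bern_union => [|u /and3P[du _ _]]; last first.
    by rewrite finset.sub0set opairs_upper // disjoint_sym.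
  apply: le_trans (sum_card_pair 5 _ (exprn_ge0 25 p0)).
  apply: ler_sum => u /and3P[du /eqP c1 /eqP c2].
  by rewrite cards0 expr0 mulr1 card_opairs // c1 c2.
- under eq_bigr do rewrite mulrA; rewrite -mulr_suml bern_moment.
  by rewrite card_upper_pairs (_ : 2 - 1 = 1) ?mul1r //; ring.
Qed.

(* Two vertices b, b' have the common neighbourhood X in w with probability
   bern_wt w p X ^ 2, which is at most bern_wt w p X * (1 - p)^|w|. *)
Lemma gnp_prob_dense p (k : nat) (w : seq 'I_n) (A : pred {set 'I_n * 'I_n}) :
  0 <= p -> p <= 1 / 2 -> uniq w -> (size w <= k)%N ->
  (forall E, ('C(n - size w, k - size w) <= ik E k * n ^ size w)%N -> A E) ->
  1 - (n ^ 2)%:R * (1 - p) ^+ size w <= gnp_prob n p A.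
Proof.
move=> p0 p2 uw wk hA.
have p01 : 0 <= p <= 1 by rewrite p0 /=; move: p2; lra.
have q0 : 0 <= 1 - p by case/andP: p01; rewrite subr_ge0.
pose W := [set x in w].
have cW : #|W| = size w by rewrite cardsE; apply/card_uniqP.
(* An index is a triple [(b, b', X)]: two vertices outside [w] whose common neighbourhood in [w] is
   to be [X], so that [Yu] must be present and [Zu] absent. *)
pose I : finType := ('I_n * 'I_n * {set 'I_n})%type.
pose Q (u : I) := [&& u.1.1 != u.1.2, u.1.1 \notin w, u.1.2 \notin w & u.2 \subset W].
pose Yu (u : I) := opairs u.2 [set u.1.1; u.1.2].
pose Zu (u : I) := opairs (W :\: u.2) [set u.1.1; u.1.2].
pose Z J : R := \sum_(u | Q u) ((Yu u \subset J) && [disjoint Zu u & J])%:R.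
have dW (u : I) : Q u -> [disjoint W & [set u.1.1; u.1.2]].
  case/and4P => _ b1 b2 _; rewrite disjoint_sym disjoint_subset.
  by apply/fintype.subsetP => x; rewrite !inE => /orP[] /eqP ->.
have dX (u : I) : Q u -> [disjoint u.2 & [set u.1.1; u.1.2]].
  by move=> Qu; case/and4P: (Qu) => _ _ _ XW; apply: disjointWl XW (dW u Qu).
have dX' (u : I) : Q u -> [disjoint W :\: u.2 & [set u.1.1; u.1.2]].
  by move=> Qu; apply: disjointWl (finset.subsetDl _ _) (dW u Qu).
apply: le_trans (gnp_prob_ge p A Z p01 _ _); last first.
- move=> J JP; apply: contraNT; rewrite -ltNge => Zlt.
  apply: hA; apply: ik_lower_fixed_set => // b b' bw b'w sep.
  apply/eqP; apply: contraLR Zlt => bb'; rewrite -leNgt.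
  pose X := [set a in w | (a, b) \in sym_graph J].
  have XW : X \subset W by apply/fintype.subsetP => x; rewrite !inE => /andP[].
  pose u0 : I := (b, b', X).
  have Qu : Q u0 by rewrite /Q /= bb' bw b'w XW.
  suff ht : (Yu u0 \subset J) && [disjoint Zu u0 & J].
    by rewrite /Z (bigD1 u0) //= ht lerDl sumr_ge0.
  apply/andP; split.
    apply/fintype.subsetP => e /imsetP[[x y]]; rewrite finset.in_setX /= => /andP[].
    rewrite inE => /andP[xw xb]; rewrite !inE => /orP[] /eqP -> ->.
      by rewrite -mem_sym_graph.
    by rewrite -mem_sym_graph // -sep.
  rewrite disjoint_subset; apply/fintype.subsetP => e /imsetP[[x y]].
  rewrite finset.in_setX /= => /andP[]; rewrite finset.in_setD !inE /= => /andP[+ xw].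
  rewrite xw /= => xb; move=> /orP[] /eqP -> ->.
    by rewrite -mem_sym_graph // inE.
  by rewrite -mem_sym_graph // -sep // inE.
- by move=> J; apply: sumr_ge0.
rewrite lerD2l lerN2 bern_union; last first.
  move=> u Qu; rewrite /Yu /Zu !opairs_upper ?dX ?dX' //; split => //.
  rewrite disjoint_subset; apply/fintype.subsetP => e /imsetP[[x y]].
  rewrite finset.in_setX /= => /andP[xX yb] ->; rewrite inE; apply/negP.
  case/imsetP => -[x' y']; rewrite finset.in_setX /= finset.in_setD => /andP[/andP[x'X x'W] y'b].
  have XW : u.2 \subset W by case/and4P: Qu.
  have xW := fintype.subsetP XW x xX.
  move/(opair_inj _ _ (dW u Qu) (x, y) (x', y')).
  rewrite !finset.in_setX /= xW x'W yb y'b => /(_ isT isT) [exx _].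
  by move: x'X; rewrite -exx xX.
apply: le_trans (_ : \sum_(b : 'I_n * 'I_n)
    \sum_(X : {set 'I_n} | X \subset W) bern_wt W p X * (1 - p) ^+ size w <= _).
  rewrite pair_big_dep /= [leLHS]big_mkcond [leRHS]big_mkcond /=.
  apply: ler_sum => u _; case: ifPn => Qu; last first.
    by case: ifP => // _; rewrite mulr_ge0 ?bern_wt_ge0 ?exprn_ge0.
  have XW : u.2 \subset W by case/and4P: (Qu).
  have bb : u.1.1 != u.1.2 by case/and4P: (Qu).
  rewrite XW /Yu /Zu !card_opairs ?dX ?dX' // !cards2 bb !muln2 -!addnn !exprD.
  (* The first factor is kept, as its sum over [X] is 1; the second is at most [(1 - p) ^+ size w]
     because [p <= 1 - p]. *)
  rewrite mulrACA; apply: ler_wpM2l; first exact: bern_wt_ge0.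
  have -> : size w = (#|u.2| + #|W :\: u.2|)%N.
    by rewrite -cW -(cardsID u.2 W) (finset.setIidPr XW).
  rewrite exprD ler_wpM2r ?exprn_ge0 // lerXn2r ?nnegrE //.
  by move: p2; lra.
under eq_bigr do rewrite -mulr_suml bern_wt_sum mul1r.
by rewrite sumr_const card_prod card_ord mulnn mulr_natl.
Qed.

End UnionBounds.

(** * Numerical estimates *)

(** Induction with (b + 1) C(M + 1, b + 1) = (M + 1) C(M, b); the step needs (M + 1) / M <= (b + 1)
    / b, which holds for b <= M. *)
Lemma expn_le_bin (M b : nat) : (b <= M)%N -> (M ^ b <= 'C(M, b) * b ^ b)%N.
Proof.
elim: b M => [|b IH] [|M] // bM.
have {}IH := IH M bM.
suff h : (M.+1 ^ b <= 'C(M, b) * b.+1 ^ b)%N.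
  by rewrite !expnS mulnA [(_ * b.+1)%N]mulnC -mul_bin_diag -mulnA leq_mul2l h orbT.
have [->|b0] := posnP b; first by rewrite bin0.
rewrite -(leq_pmul2r (m := (b ^ b)%N)) ?expn_gt0 ?b0 //.
apply: leq_trans (_ : (b.+1 ^ b * M ^ b) <= _)%N.
  by rewrite -!expnMn leq_exp2r //; move: bM; rewrite ltnS => bM; nia.
by rewrite mulnAC mulnC leq_mul2r IH orbT.
Qed.

Section Estimates.
Context {R : realType}.
Implicit Types (x y z u v : R).

Lemma expR_ge_cube y : 0 <= y -> y ^+ 3 <= 27 * expR y.
Proof.
move=> y0; have -> : y = 3%:R * (y / 3) by field.
rewrite expRM_natl exprMn (_ : 3 ^+ 3 = 27 :> R); last by ring.
rewrite ler_pM2l // lerXn2r ?nnegrE ?expR_ge0 ?divr_ge0 //.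
by have := expR_ge1Dx (y / 3); lra.
Qed.

Lemma onem_expn_le (p : R) (m : nat) : p <= 1 -> (1 - p) ^+ m <= expR (- (p * m%:R)).
Proof.
move=> p1; rewrite -mulNr expRM_natr lerXn2r ?nnegrE ?expR_ge0 ?subr_ge0 //.
exact: expR_ge1Dx.
Qed.

Lemma oneD_expn_le (p : R) (m : nat) : 0 <= p -> (1 + p) ^+ m <= expR (p * m%:R).
Proof.
by move=> p0; rewrite expRM_natr lerXn2r ?nnegrE ?expR_ge0 ?addr_ge0 // expR_ge1Dx.
Qed.

Lemma expR1_ge2 : 2 <= expR 1 :> R.
Proof. by have := expR_ge1Dx (1 : R); lra. Qed.

Lemma expR_half_le2 : expR (1 / 2) <= 2 :> R.
Proof.
have h1 := expR_ge1Dx (- (1 / 2) : R); have h0 := expR_gt0 (1 / 2 : R).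
have : expR (1 / 2) * expR (- (1 / 2)) = 1 :> R by rewrite -expRD subrr expR0.
by move: h1 h0; set a := expR (1 / 2); set b := expR _; nra.
Qed.

(** Weak Stirling bound s! >= (s / e)^s; the induction step uses (1 + 1 / s)^s <= e. *)
Lemma expn_le_fact_expR (s : nat) : s%:R ^+ s <= s`!%:R * expR s%:R :> R.
Proof.
elim: s => [|s IH]; first by rewrite expr0 fact0 mul1r expR0.
rewrite factS natrM exprS -mulrA ler_wpM2l //.
have -> : s.+1%:R = s%:R + 1 :> R by rewrite -natr1.
rewrite expRD mulrA; have [->|s0] := posnP s.
  by rewrite expr0 fact0 !mul1r expR0 mul1r; have := expR1_ge2; lra.
have s1 : 0 < s%:R :> R by rewrite ltr0n.
have -> : s%:R + 1 = s%:R * (1 + s%:R^-1) :> R by field; rewrite gt_eqF.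
rewrite exprMn; apply: ler_pM; rewrite ?exprn_ge0 ?addr_ge0 ?invr_ge0 //.
apply: le_trans (oneD_expn_le _ _ _) _; first by rewrite invr_ge0 ltW.
by rewrite mulVf // gt_eqF.
Qed.

Lemma ffact_le_expn (n s : nat) : (n ^_ s <= n ^ s)%N.
Proof.
elim: s n => [|s IH] [|n] //; rewrite ?ffact0n // ffactSS expnS leq_mul2l /=.
by apply: leq_trans (IH n) _; case: s {IH} => // s; rewrite leq_exp2r.
Qed.

Lemma bin_le_expn (n s : nat) : ('C(n, s) <= n ^ s)%N.
Proof.
apply: leq_trans (ffact_le_expn n s); rewrite -bin_ffact.
by rewrite leq_pmulr // fact_gt0.
Qed.

Lemma bin_le_expR (n s : nat) : (0 < s)%N ->
  'C(n, s)%:R <= (n%:R * expR 1 / s%:R) ^+ s :> R.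
Proof.
move=> s0; have s1 : 0 < s%:R :> R by rewrite ltr0n.
rewrite expr_div_n ler_pdivlMr ?exprn_gt0 // exprMn -expRM_natr mul1r.
apply: le_trans (_ : 'C(n, s)%:R * (s`!%:R * expR s%:R) <= _).
  by rewrite ler_wpM2l // expn_le_fact_expR.
rewrite mulrA ler_wpM2r ?expR_ge0 // -natrM bin_ffact -natrX ler_nat.
exact: ffact_le_expn.
Qed.

Lemma truncn_bounds x : 1 <= x ->
  [/\ (Num.trunc x)%:R <= x, x / 2 <= (Num.trunc x)%:R & (0 < Num.trunc x)%N].
Proof.
move=> x1; have /andP[lo hi] := truncn_itv (le_trans ler01 x1).
have t0 : (0 < Num.trunc x)%N by rewrite truncn_gt0.
split => //; have : 1 <= (Num.trunc x)%:R :> R by rewrite ler1n.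
by move: hi; rewrite -natr1; lra.
Qed.

(** Write u for the logarithm and b = k - a >= k / 2. Since 16 <= e^4, M / b >= exp(u - 4), so the
    binomial is at least exp(k (u - 4) / 2). Dividing by [L] leaves exp(k u / 4 - 2 k), which
    exceeds exp(k u / 8) once u > 16. *)
Lemma ik_count_bound (n k M a I L : nat) :
  (0 < k)%N -> (n <= 16 * M)%N -> (2 * a <= k)%N ->
  ('C(M, k - a) <= I * L)%N -> 24 <= ln (n%:R / k%:R : R) ->
  L%:R <= expR (k%:R * ln (n%:R / k%:R) / 4) :> R ->
  expR (k%:R * ln (n%:R / k%:R) / 8) < I%:R :> R.
Proof.
move=> k0 nM ak cM; set u := ln _ => u24 Lu.
have k1 : 0 < k%:R :> R by rewrite ltr0n.
have x0 : 0 < n%:R / k%:R :> R.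
  by rewrite ltNge; apply/negP => /ln0; rewrite -/u => u0; move: u24; rewrite u0; lra.
have xE : n%:R = k%:R * expR u :> R.
  by rewrite /u lnK ?posrE // mulrC divfK // gt_eqF.
have e4 : 16 <= expR 4 :> R.
  have -> : 4 = 4%:R * 1 :> R by rewrite mulr1.
  rewrite expRM_natl; apply: le_trans (_ : 2 ^+ 4 <= _); first by lra.
  by rewrite lerXn2r ?nnegrE ?expR_ge0 // expR1_ge2.
have xl : expR (u - 4) * k%:R <= M%:R :> R.
  rewrite -(ler_pM2l (_ : 0 < 16 :> R)) //.
  apply: le_trans (_ : n%:R <= _); last by rewrite -natrM ler_nat.
  have ai : (expR 4)^-1 <= 16^-1 :> R by rewrite lef_pV2 ?posrE ?expR_gt0.
  rewrite xE expRB; have : 0 <= expR u * k%:R * (16^-1 - (expR 4)^-1).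
    by rewrite !mulr_ge0 ?expR_ge0 // subr_ge0.
  by set c := expR u; set K := k%:R; set e := (expR 4)^-1; lra.
set b := (k - a)%N in cM.
have b0 : (0 < b)%N by rewrite /b; lia.
have bk : k%:R <= 2 * b%:R :> R by rewrite -natrM ler_nat /b; lia.
have bk' : b%:R <= k%:R :> R by rewrite ler_nat leq_subr.
have b1 : 0 < b%:R :> R by rewrite ltr0n.
have eu : 1 <= expR (u - 4) by rewrite -[leLHS]expR0 ler_expR; move: u24; lra.
have bM : (b <= M)%N.
  rewrite -(ler_nat R); apply: le_trans bk' (le_trans _ xl).
  by rewrite ler_peMl // ltW.
have lower : expR (b%:R * (u - 4)) <= I%:R * L%:R.
  have : 'C(M, b)%:R <= I%:R * L%:R :> R by rewrite -natrM ler_nat.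
  apply: le_trans; rewrite expRM_natl -(ler_pM2r (exprn_gt0 b b1)) -exprMn.
  apply: le_trans (_ : M%:R ^+ b <= _).
    apply: lerXn2r; rewrite ?nnegrE ?mulr_ge0 ?expR_ge0 //.
    by apply: le_trans xl; rewrite ler_wpM2l ?expR_ge0.
  by rewrite -!natrX -natrM ler_nat expn_le_bin.
have L0 : 0 < L%:R :> R.
  rewrite lt0r ler0n andbT; apply: contraTneq lower => ->.
  by rewrite mulr0 -ltNge expR_gt0.
rewrite -(ltr_pM2r L0); apply: lt_le_trans lower.
apply: le_lt_trans (ler_wpM2l (expR_ge0 _) Lu) _.
rewrite -expRD ltr_expR.
have : k%:R * (u - 4) <= 2 * b%:R * (u - 4) by rewrite ler_wpM2r //; move: u24; lra.
have : 24 * k%:R <= k%:R * u by rewrite mulrC ler_wpM2l // ltW.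
by move: k1; set K := k%:R; set B := b%:R; move=> ? ? ?; lra.
Qed.

End Estimates.

(** * The dense and the sparse regime *)

Section Regimes.
Context {R : realType}.
Context (n k : nat) (u v z : R) (A : pred {set 'I_n * 'I_n}).
(** Logarithmic parameters: [z] is ln n, [u] is ln (n / k) and [v] is ln d, so that [2 * u <= v]
    says d >= (n / k)^2. *)
Let p : R := expR (v - z).
Context (nE : n%:R = expR z) (kE : k%:R = expR (z - u)).
Context (u_large : 1000 * 100 <= u) (uv : 2 * u <= v) (p_half : p <= 1 / 2).
Context (A_ik : forall E, expR (k%:R * u / 8) < (ik E k)%:R -> A E).

(** Here exp(y / 2) >= y^3 / 216, which for y >= 200000 is more than 900 y^2, against a leading term
    480 y^2. *)
Lemma quadratic_le_expR (y : R) : 1000 * 200 <= y ->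
  80 * (y + 3) * (6 * y + 1) <= expR (y / 2).
Proof.
move=> hy; have := expR_ge_cube (y / 2); rewrite divr_ge0; last by lra.
  move=> /(_ isT); rewrite (_ : (y / 2) ^+ 3 = y * y * y / 8); last by field.
  have y0 : 0 <= y by lra.
  have y1 : 0 <= y - 1000 * 200 by lra.
  have := mulr_ge0 (mulr_ge0 y0 y0) y1; have := mulr_ge0 y0 y1.
  move: hy y0; clear y1.
  by set e := expR _; lra.
by lra.
Qed.

Let v_lt_z : v < z.
Proof.
have : p < 1 by move: p_half; lra.
by rewrite /p expR_lt1 subr_lt0.
Qed.

Let z_large : 1000 * 200 <= z.
Proof. by move: u_large uv v_lt_z; lra. Qed.

Let p01 : 0 <= p <= 1.
Proof. by rewrite expR_ge0; move: p_half; lra. Qed.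

(** As 2 u <= v < z, k = exp(z - u) is at least exp(z / 2). *)
Let k_large : 80 * (z + 3) * (6 * z + 1) <= k%:R.
Proof.
apply: le_trans (quadratic_le_expR z z_large) _.
by rewrite kE ler_expR; move: uv v_lt_z; lra.
Qed.

Let k_gt0 : (0 < k)%N.
Proof. by rewrite -(ltr0n R) kE expR_gt0. Qed.

Let k_le_n : (k <= n)%N.
Proof. by rewrite -(ler_nat R) nE kE ler_expR; move: u_large; lra. Qed.

Let uE : ln (n%:R / k%:R) = u :> R.
Proof. by rewrite nE kE -expRN -expRD (_ : z + - (z - u) = u) ?expRK //; ring. Qed.

Let pk : p * k%:R = expR (v - u).
Proof. by rewrite kE -expRD; congr expR; ring. Qed.

(** The size a of the fixed set is k u / (8 z) rounded down, which gives n^a <= exp(k u / 8). The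
    error n^2 (1 - p)^a is at most 1 / n once p a >= 3 z; this holds because p k = exp(v - u) with v
    - u >= v / 2 >= 7 z / 25. *)
Lemma dense_regime : 14 * z <= 25 * v -> 1 - n%:R^-1 <= gnp_prob n p A.
Proof.
move=> vz; have z0 : 0 < z by move: z_large; lra.
have K0 : 0 <= k%:R :> R by [].
pose t := k%:R * u / (8 * z).
have tE : t * (8 * z) = k%:R * u by rewrite /t divfK // mulf_neq0 ?gt_eqF.
have zk : 8 * z <= k%:R.
  apply: le_trans k_large; have : 0 <= z * z by rewrite mulr_ge0 // ltW.
  by move: z0; lra.
have zKu : 8 * z <= k%:R * u.
  by apply: le_trans zk _; rewrite ler_peMr //; move: u_large; lra.
have t1 : 1 <= t by rewrite /t ler_pdivlMr ?mul1r // mulr_gt0.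
clearbody t; have [] := truncn_bounds t t1.
move: (Num.trunc t) => a at_ ta a0.
have tk : 8 * t <= k%:R.
  rewrite -(ler_pM2r z0); have : k%:R * u <= k%:R * z.
    by apply: ler_wpM2l => //; move: uv v_lt_z u_large; lra.
  by move: tE; lra.
have ak : (8 * a <= k)%N.
  by rewrite -(ler_nat R) natrM; move: at_ tk; lra.
have sw : size (take a (enum 'I_n)) = a.
  by apply: size_takel; rewrite size_enum_ord; have := k_le_n; move: ak; clear; lia.
have x24 : 24 <= ln (n%:R / k%:R) :> R by rewrite uE; move: u_large; lra.
apply: le_trans (gnp_prob_dense p k (take a (enum 'I_n)) A _ p_half _ _ _).
- rewrite sw lerD2l lerN2 natrX nE -expRM_natl -expRN.
  apply: le_trans (ler_wpM2l (expR_ge0 _) (onem_expn_le _ a _)) _.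
    by case/andP: p01.
  rewrite -expRD ler_expR.
  have pa : p * t <= 2 * (p * a%:R).
    have p0 : 0 <= p by rewrite expR_ge0.
    rewrite mulrCA; apply: ler_wpM2l => //; move: ta; lra.
  suff : 6 * z <= p * t by move: pa; lra.
  have z80 : 0 < 8 * z by rewrite mulr_gt0.
  rewrite -(ler_pM2r z80) -[leRHS]mulrA tE [leRHS]mulrA pk.
  have e1 : 48 * z * z <= expR (v - u).
    apply: le_trans (_ : expR (7%:R / 25%:R * z) <= _); last first.
      by rewrite ler_expR; move: uv vz; lra.
    have q0 : 0 <= 7%:R / 25%:R * z by move: z0; lra.
    have := expR_ge_cube _ q0.
    rewrite (_ : (_ * z) ^+ 3 = 343%:R / 15625%:R * (z * z * z)); last by field.
    have z1 : 0 <= z - 1000 * 200 by move: z_large; lra.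
    have := mulr_ge0 (mulr_ge0 (ltW z0) (ltW z0)) z1; have := mulr_ge0 (ltW z0) (ltW z0).
    by set e := expR _; lra.
  apply: le_trans (_ : expR (v - u) * 1 <= _); first by move: e1; lra.
  by rewrite ler_wpM2l ?expR_ge0 //; move: u_large; lra.
- by rewrite expR_ge0.
- by rewrite take_uniq // enum_uniq.
- by rewrite sw; move: ak; clear; lia.
- move=> E; rewrite sw => cE; apply: A_ik; rewrite -uE.
  apply: (ik_count_bound n k (n - a) a _ (n ^ a)) => //.
  + by have := k_le_n; move: ak; clear; lia.
  + by move: ak; clear; lia.
  rewrite uE natrX nE -expRM_natl ler_expR.
  have : a%:R * z <= t * z by rewrite ler_wpM2r // ltW.
  have : 0 <= k%:R * u by rewrite mulr_ge0 //; move: u_large; lra.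
  by move: tE; lra.
Qed.


(** The parameters are s about k u / (40 (v + 3)), [Delta] about 8 d and m about 2 n d. Each of the
    three error terms is at most exp(-z) = 1 / n. *)
Lemma sparse_regime : 25 * v <= 14 * z -> 1 - 3 / n%:R <= gnp_prob n p A.
Proof.
move=> vz; have z0 : 0 < z by move: z_large; lra.
have v_large : 1000 * 200 <= v by move: u_large uv; lra.
have v0 : 0 < v by move: v_large; lra.
have K0 : 0 <= k%:R :> R by [].
have p0 : 0 <= p by rewrite expR_ge0.
have p1 : p <= 1 by case/andP: p01.
(* Since 8 <= e^3, [l] is an upper bound for ln (8 d). *)
pose l := v + 3; have l0 : 0 < l by rewrite /l; lra.
pose t := k%:R * u / (40 * l).
have tE : t * (40 * l) = k%:R * u by rewrite /t divfK // mulf_neq0 ?gt_eqF.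
clearbody t.
have zK : 80 * (l * z) <= k%:R.
  apply: le_trans k_large; rewrite /l.
  have := mulr_ge0 (ltW z0) (ltW z0).
  have : 0 <= z * (z - v) by rewrite mulr_ge0 ?ltW // subr_gt0 v_lt_z.
  by move: z0; lra.
have KKu : k%:R <= k%:R * u by rewrite ler_peMr //; move: u_large; lra.
have t2z : 2 * z <= t.
  have l40 : 0 < 40 * l by rewrite mulr_gt0.
  by rewrite -(ler_pM2r l40) tE; move: zK KKu; lra.
have tk : 40 * t <= k%:R.
  rewrite -(ler_pM2r l0); have : k%:R * u <= k%:R * l.
    by apply: ler_wpM2l => //; rewrite /l; move: uv u_large; lra.
  by move: tE; lra.
have t1 : 1 <= t by move: t2z z_large; lra.
have [] := truncn_bounds t t1; move: (Num.trunc t) => s st ts s0.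
have zs : z <= s%:R by move: ts t2z; lra.
have sk : (40 * s <= k)%N by rewrite -(ler_nat R) natrM; move: st tk; lra.
pose d := expR v; have d1 : 2 <= d.
  by have := expR_ge1Dx v; rewrite -/d; move: v_large; lra.
have [] := truncn_bounds (8 * d) _; first by lra.
have := truncnS_gt (8 * d); move: (Num.trunc (8 * d)) => Delta D1 D2 _ D0.
have nd : n%:R * d = expR (v + z) by rewrite nE -expRD addrC.
have nd1 : 2 * (1 + z) <= n%:R * d.
  rewrite mulrC nE; apply: ler_pM => //; first by rewrite addr_ge0 // ltW.
  exact: expR_ge1Dx.
have [] := truncn_bounds (2 * (n%:R * d)) _; first by move: nd1 z0; lra.
have := truncnS_gt (2 * (n%:R * d)).
move: (Num.trunc (2 * (n%:R * d))) => m m1 m2 _ _.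
have mD : (4 * m <= n * Delta.+1)%N.
  rewrite -(ler_nat R) !natrM; have : n%:R * (8 * d) <= n%:R * Delta.+1%:R.
    by rewrite ler_wpM2l // ltW.
  by move: m2; lra.
have x24 : 24 <= ln (n%:R / k%:R) :> R by rewrite uE; move: u_large; lra.
have e8 : 8 <= expR 3 :> R.
  have -> : 3 = 3%:R * 1 :> R by rewrite mulr1.
  rewrite expRM_natl; apply: le_trans (_ : 2 ^+ 3 <= _); first by lra.
  by apply: lerXn2r; rewrite ?nnegrE ?expR_ge0 ?expR1_ge2.
(* [n * Delta ^ (5 * s)] is at most exp(z + 5 s l), where 5 s l <= k u / 8 by the choice of [t], and
   z <= k u / 8 as well. *)
have hA E M : (n <= 16 * M)%N ->
    ('C(M, k - 5 * s) <= ik E k * (n * Delta ^ (5 * s)))%N -> A E.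
  move=> nM cM; apply: A_ik; rewrite -uE.
  apply: (ik_count_bound n k M (5 * s) _ _ k_gt0 nM _ cM x24).
    by move: sk; clear; lia.
  rewrite uE natrM natrX.
  apply: le_trans (_ : expR z * expR l ^+ (5 * s) <= _).
    rewrite nE ler_wpM2l ?expR_ge0 //; apply: lerXn2r; rewrite ?nnegrE ?expR_ge0 //.
    by apply: le_trans D2 _; rewrite /l expRD mulrC ler_wpM2l ?expR_ge0.
  rewrite -expRM_natl -expRD ler_expR natrM.
  have : s%:R * l <= t * l by rewrite ler_wpM2r // ltW.
  have : z <= l * z by rewrite ler_peMl ?ltW // /l; lra.
  by move: tE zK KKu z0; lra.
apply: le_trans (gnp_prob_sparse p k s Delta m A p01 hA mD D0 s0 _ _); last 2 first.
- by have := k_le_n; move: sk; clear; lia.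
- by move: sk; clear; lia.
have nV : n%:R^-1 = expR (- z) :> R by rewrite nE expRN.
rewrite lerD2l lerN2 (_ : 3 / n%:R = expR (- z) + expR (- z) + expR (- z)); last first.
  by rewrite nV; ring.
have s1 : 0 < s%:R :> R by rewrite ltr0n.
have ev := quadratic_le_expR v v_large.
apply: lerD; first apply: lerD.
(* C(n, s) <= (n e / s)^s <= exp(3 v s), while (1 - p)^(s^2) <= exp(-s (6 v + 1)); the whole term is
   at most exp(-s), and s >= z. *)
- have base : n%:R * expR 1 / s%:R <= expR (3 * v).
    rewrite ler_pdivrMr //; apply: le_trans (_ : expR (3 * v) * (t / 2) <= _); last first.
      by rewrite ler_wpM2l ?expR_ge0.
    have l80 : 0 < 80 * l by rewrite mulr_gt0.
    rewrite -(ler_pM2r l80).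
    have -> : expR (3 * v) * (t / 2) * (80 * l) = expR (3 * v) * (k%:R * u).
      by rewrite -tE; field.
    have nK : n%:R = k%:R * expR u :> R by rewrite nE kE -expRD; congr expR; ring.
    apply: le_trans (ler_wpM2l (expR_ge0 _) KKu).
    have -> : n%:R * expR 1 * (80 * l) = (80 * l * expR (u + 1)) * k%:R.
      by rewrite nK expRD; ring.
    apply: ler_wpM2r => //.
    apply: le_trans (_ : expR (v / 2) * expR (u + 1) <= _).
      apply: ler_wpM2r; first exact: expR_ge0.
      apply: le_trans ev; rewrite /l; have := mulr_ge0 (ltW v0) (ltW v0).
      by move: v0; lra.
    by rewrite -expRD ler_expR; move: uv v_large u_large; lra.
  have ps : 6 * v + 1 <= p * s%:R.
    have : p * (t / 2) <= p * s%:R by rewrite ler_wpM2l.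
    apply: le_trans; have l80 : 0 < 80 * l by rewrite mulr_gt0.
    rewrite -(ler_pM2r l80).
    have -> : p * (t / 2) * (80 * l) = p * k%:R * u.
      by rewrite -[RHS]mulrA -tE; field.
    rewrite pk; apply: le_trans (_ : expR (v / 2) * 1 <= _).
      by rewrite mulr1; apply: le_trans ev; rewrite /l; lra.
    apply: ler_pM; rewrite ?expR_ge0 ?ler_expR //; move: uv u_large; lra.
  have CB : 'C(n, s)%:R <= expR (3 * v) ^+ s :> R.
    apply: le_trans (bin_le_expR n s s0) _; apply: lerXn2r => //.
      by rewrite nnegrE divr_ge0 // mulr_ge0 ?expR_ge0.
    by rewrite nnegrE expR_ge0.
  apply: le_trans (_ : (expR (3 * v) ^+ s) ^+ 2 * expR (- (p * s%:R)) ^+ s <= _).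
    apply: ler_pM; rewrite ?exprn_ge0 ?subr_ge0 //.
      by rewrite natrX; apply: lerXn2r; rewrite ?nnegrE ?exprn_ge0 ?expR_ge0.
    rewrite exprM; apply: lerXn2r; rewrite ?nnegrE ?exprn_ge0 ?expR_ge0 ?subr_ge0 //.
    exact: onem_expn_le.
  rewrite -!expRM_natl -expRD ler_expR.
  have : s%:R * (6 * v + 1) <= s%:R * (p * s%:R) by rewrite ler_wpM2l.
  by move: zs; lra.
(* n^10 p^25 = exp(25 v - 15 z) is at most exp(-z) exactly when 25 v <= 14 z: this fixes the
   boundary between the regimes. *)
- apply: le_trans (_ : (n%:R ^+ 5) ^+ 2 * p ^+ 25 <= _).
    rewrite ler_wpM2r ?exprn_ge0 // natrX; apply: lerXn2r; rewrite ?nnegrE ?exprn_ge0 //.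
    by rewrite -natrX ler_nat bin_le_expn.
  rewrite nE -exprM -expRM_natl /p -expRM_natl -expRD ler_expR natrM.
  by move: vz; lra.
(* The mean number of edges is at most n d / 2, whereas 2^m >= exp(m / 2) with m > 2 n d - 1. *)
- have h1 : (1 + p) ^+ 'C(n, 2) <= expR (n%:R * d / 2).
    apply: le_trans (oneD_expn_le p _ p0) _; rewrite ler_expR.
    have -> : n%:R * d = p * (n%:R * n%:R).
      by rewrite nd nE -!expRD; congr expR; ring.
    have hN : 'C(n, 2)%:R * 2 <= n%:R * n%:R :> R.
      have hN : ('C(n, 2) * 2`! <= n ^ 2)%N by rewrite bin_ffact ffact_le_expn.
      by rewrite -(ler_nat R) natrM natrX expr2 in hN.
    have := ler_wpM2l p0 hN; lra.
  have h2 : expR (m%:R / 2) <= 2 ^+ m :> R.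
    rewrite (_ : m%:R / 2 = m%:R * (1 / 2)); last by rewrite mul1r.
    by rewrite expRM_natl; apply: lerXn2r; rewrite ?nnegrE ?expR_ge0 ?expR_half_le2.
  rewrite ler_pdivrMr ?exprn_gt0 //; apply: le_trans h1 _.
  apply: le_trans (ler_wpM2l (expR_ge0 _) h2).
  by rewrite -expRD ler_expR; move: m1; rewrite -[m.+1%:R]natr1; move: nd1; lra.
Qed.

End Regimes.

(** * From the regimes to the theorem *)

Lemma ik_gt0 {n : nat} (E : {set 'I_n * 'I_n}) (k : nat) : (k <= n)%N -> (0 < ik E k)%N.
Proof.
move=> kn; have [|S _ cS] := @subset_of_card _ [set: 'I_n] k.
  by rewrite cardsT card_ord.
apply/card_gt0P; exists [set T : {set 'I_n} | (#|T| == k) && induced_iso E S T].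
by apply/imsetP; exists S; rewrite // inE cS.
Qed.

(** Passes to the logarithmic parameters: k >= n / sqrt d becomes 2 u <= v, and d <= n / 2 becomes p
    <= 1 / 2. The cases split at d = n^(14/25). *)
Lemma gnp_prob_ik_gt {R : realType} (n k : nat) (d : R) (A : pred {set 'I_n * 'I_n}) :
  (0 < n)%N -> 1 <= d -> d <= n%:R / 2 -> n%:R / Num.sqrt d <= k%:R ->
  1000 * 100 <= ln (n%:R / k%:R) :> R ->
  (forall E, expR (k%:R * ln (n%:R / k%:R) / 8) < (ik E k)%:R :> R -> A E) ->
  1 - 3 / n%:R <= gnp_prob n (d / n%:R) A.
Proof.
move=> n0 d1 dn kd u_large hA; set u := ln _ in u_large hA.
have n1 : 0 < n%:R :> R by rewrite ltr0n.
have d0 : 0 < d by lra.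
have sd0 : 0 < Num.sqrt d by rewrite sqrtr_gt0.
have k1 : 0 < k%:R :> R by apply: lt_le_trans kd; rewrite divr_gt0.
pose v := ln d; pose z := ln n%:R : R.
have dE : d = expR v by rewrite lnK.
have nE : n%:R = expR z :> R by rewrite lnK.
have kE : k%:R = expR (z - u) :> R.
  by rewrite expRB -nE lnK ?posrE ?divr_gt0 // invf_div mulrC divfK // gt_eqF.
have uv : 2 * u <= v.
  rewrite -ler_expR -dE expRM_natl lnK ?posrE ?divr_gt0 //.
  have xd : n%:R / k%:R <= Num.sqrt d.
    by rewrite ler_pdivrMr // mulrC -ler_pdivrMr.
  rewrite -[leRHS]sqr_sqrtr; last exact: ltW.
  apply: lerXn2r => //.
    by rewrite nnegrE divr_ge0.
  by rewrite nnegrE ltW.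
have pE : d / n%:R = expR (v - z) by rewrite expRB -dE -nE.
have p_half : expR (v - z) <= 1 / 2.
  by rewrite -pE ler_pdivrMr // mul1r mulrC.
rewrite pE; have [vz|/ltW zv] := leP (25 * v) (14 * z).
  exact: (@sparse_regime R n k u v z A).
apply: le_trans (_ : 1 - n%:R^-1 <= _); last exact: (@dense_regime R n k u v z A).
have : 0 < n%:R^-1 :> R by rewrite invr_gt0.
by lra.
Qed.

Local Open Scope classical_set_scope.
Local Open Scope ring_scope.

Theorem theorem3p5 (R : realType) :
  exists delta0 : R, 0 < delta0 /\
  forall delta : R, 0 < delta -> delta < delta0 ->
  forall (d : nat -> R) (k : nat -> nat),
    (exists N0 : nat, forall n : nat, (N0 <= n)%N ->
       [/\ 1 <= d n, d n <= n%:R / 2,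
           n%:R / Num.sqrt (d n) <= (k n)%:R
         & (k n)%:R <= Num.sqrt delta * n%:R]) ->
    (fun n : nat =>
       gnp_prob n (d n / n%:R)
         [pred E | (delta * (n%:R / (k n)%:R) `^ (delta / 2)) ^+ (k n)
                     < (ik E (k n))%:R])
      @ \oo --> (1 : R).
Proof.
(* This value makes the base of the bound less than 1 as long as ln (n / k) < 100000. It is also
   below 1/4, so that for larger n / k the exponent [delta / 2] is at most 1/8. *)
exists (expR (- (1000 * 100))); split; first exact: expR_gt0.
move=> delta delta0 delta_small d k [N0 hN0].
have delta1 : delta <= 1 / 4.
  have h : expR (- (1000 * 100)) <= expR (- 2) :> R by rewrite ler_expR; lra.
  have e2 : 4 <= expR 2 :> R.
    rewrite -[X in _ <= expR X]mulr1 expRM_natl expr2; have := @expR1_ge2 R.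
    by set a := expR 1; nra.
  have : expR (- 2) * expR 2 = 1 :> R by rewrite -expRD addNr expR0.
  have := expR_gt0 (- 2 : R); move: h e2 delta_small.
  by set a := expR _; set b := expR (- 2); set c := expR 2; nra.
set f := (X in X @ \oo --> _).
(* Squeeze between 1 - 3 / n and 1; [harmonic] at [n.-1] is 1 / n, hence the shift. *)
suff bnd : \forall n \near \oo, 1 - 3 * harmonic n.-1 <= f n <= 1.
  apply: (squeeze_cvgr bnd); last exact: cvg_cst.
  rewrite -[X in _ --> X]subr0 -[X in _ - X](mulr0 3).
  apply: cvgB; first exact: cvg_cst.
  apply: cvgM; first exact: cvg_cst.
  rewrite -(cvg_shiftS (fun n => harmonic n.-1 : R^o)) /=.
  exact: cvg_harmonic.
exists (maxn N0 1) => // n /=; rewrite geq_max => /andP[nN0 n0].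
have [d1 dn kd kn] := hN0 n nN0; rewrite prednK //.
have n1 : 0 < n%:R :> R by rewrite ltr0n.
have p01 : 0 <= d n / n%:R <= 1.
  rewrite divr_ge0 //=; last by lra.
  by rewrite ler_pdivrMr // mul1r; lra.
rewrite /f gnp_prob_le1 // andbT.
have k1 : 0 < (k n)%:R :> R.
  by apply: lt_le_trans kd; rewrite divr_gt0 // sqrtr_gt0; lra.
have k0 : (0 < k n)%N by rewrite -(ltr0n R).
have kn' : (k n <= n)%N.
  rewrite -(ler_nat R); apply: le_trans kn _; rewrite ler_piMl //.
  by rewrite -(@sqrtr1 R) ler_sqrt //; lra.
set x := n%:R / (k n)%:R; have x1 : 1 <= x by rewrite ler_pdivlMr // mul1r ler_nat.
have x0 : 0 < x by apply: lt_le_trans x1.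
pose u := ln x; have u0 : 0 <= u by rewrite ln_ge0.
have xpow : x `^ (delta / 2) = expR (delta / 2 * u) by rewrite /powR gt_eqF.
have [u_large|u_small] := leP (1000 * 100) u.
  apply: (gnp_prob_ik_gt n (k n) (d n)) => // E hE /=; apply: le_lt_trans hE.
  rewrite -/x -/u -mulrA expRM_natl; apply: lerXn2r; rewrite ?nnegrE ?expR_ge0 //.
    by rewrite mulr_ge0 ?powR_ge0 // ltW.
  rewrite xpow -[leRHS]mul1r; apply: ler_pM; rewrite ?expR_ge0 ?ler_expR //.
  - exact: ltW.
  - by lra.
  - have : delta * u <= 1 / 4 * u by rewrite ler_wpM2r.
    by move: u0; lra.
(* In the remaining case the bound is a positive power of a number below 1, while [ik] is at least
   1; the event holds for every graph, and the first-moment bound is applied with zero. *)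
have base_lt1 : delta * x `^ (delta / 2) < 1.
  rewrite xpow; apply: lt_le_trans (_ : expR (- (1000 * 100)) * expR (delta / 2 * u) <= _).
    by rewrite ltr_pM2r // expR_gt0.
  rewrite -expRD expR_le1; have : delta / 2 * u <= 1 * u by rewrite ler_wpM2r //; lra.
  by move: u_small; lra.
apply: le_trans (gnp_prob_ge (d n / n%:R) _ (fun=> 0) p01 _ _) => //.
  rewrite big1 ?subr0; last by move=> J _; rewrite mulr0.
  by rewrite gerBl mulr_ge0 // invr_ge0.
move=> J _ /=; rewrite -leNgt => ik_le.
have ik1 : (1 : R) <= (ik (sym_graph J) (k n))%:R by rewrite ler1n ik_gt0.
suff lt1 : (delta * x `^ (delta / 2)) ^+ k n < 1.
  by have := le_lt_trans (le_trans ik1 ik_le) lt1; rewrite ltxx.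
rewrite exprn_ilt1 -?lt0n //; apply: mulr_ge0; last exact: powR_ge0.
exact: ltW.
Qed.
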